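(* Let $k\ge\ell\ge2$ be integers with $k\ge3$. The number of minimal $(k,\ell)$-bicrucial permutations is $$\frac{(1+\delta_{k,\ell})\,(k+2\ell-5)!}{(k+\ell-3)(k+\ell-4)\,(\ell-1)!\,(\ell-2)!\,(k-3)!},$$ where $\delta_{k,\ell}$ is the Kronecker delta ($\delta_{k,\ell}=1$ if $k=\ell$ and $0$ otherwise).
   Context: $i_m=12\cdots m$ and $d_m=m(m-1)\cdots 1$; a permutation (in one-line notation) contains $i_m$ (resp. $d_m$) if it has an increasing (resp. decreasing) subsequence of length $m$, and avoids it otherwise. For $1\le t\le n+1$ put $e_t(x)=x$ if $x<t$ and $e_t(x)=x+1$ if $x\ge t$. The extensions of a permutation $\sigma=\sigma_1\cdots\sigma_n$ of $\{1,\ldots,n\}$ ($n\ge1$) to the right are $e_t(\sigma_1)\cdots e_t(\sigma_n)\,t$, and to the left are $t\,e_t(\sigma_1)\cdots e_t(\sigma_n)$, for $1\le t\le n+1$. A permutation is $(k,\ell)$-bicrucial if it avoids $i_k$ and $d_\ell$ but each of its extensions to the right and each of its extensions to the left contains $i_k$ or $d_\ell$. Such a permutation is minimal if there is no $(k,\ell)$-bicrucial permutation (same $k,\ell$) of smaller length. *)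

(* Defs.v *)
From mathcomp Require Import all_boot all_fingroup all_algebra.

Set Implicit Arguments.
Unset Strict Implicit.
Unset Printing Implicit Defensive.

(* A permutation sigma of {1, ..., n} is an s : 'S_n, positions and values both
   being shifted down by one: s i = sigma_(i+1) - 1. *)

Definition contains_inc (m n : nat) (s : 'S_n) : bool :=
  [exists A : {set 'I_n}, (#|A| == m) &&
    [forall i in A, forall j in A, (i < j) ==> (s i < s j)]].

Definition contains_dec (m n : nat) (s : 'S_n) : bool :=
  [exists A : {set 'I_n}, (#|A| == m) &&
    [forall i in A, forall j in A, (i < j) ==> (s j < s i)]].

(* lift_perm i t s puts t at position i, and the entries of s, in order, at the
   other positions, each entry x becoming x + 1 if t <= x; i.e., x is replaced
   with e_t(x). *)
Definition ext_right (n : nat) (t : 'I_n.+1) (s : 'S_n) : 'S_n.+1 :=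
  lift_perm ord_max t s.

Definition ext_left (n : nat) (t : 'I_n.+1) (s : 'S_n) : 'S_n.+1 :=
  lift_perm ord0 t s.

Definition bicrucial (k l n : nat) (s : 'S_n) : bool :=
  [&& 0 < n,
      ~~ contains_inc k s,
      ~~ contains_dec l s,
      [forall t : 'I_n.+1, contains_inc k (ext_right t s)
                           || contains_dec l (ext_right t s)]
    & [forall t : 'I_n.+1, contains_inc k (ext_left t s)
                           || contains_dec l (ext_left t s)]].

Definition minimal_bicrucial (k l n : nat) (s : 'S_n) : bool :=
  bicrucial k l s && [forall m : 'I_n, forall u : 'S_m, ~~ bicrucial k l u].

(* Main.v *)
Require Import Defs.
From mathcomp Require Import all_boot all_fingroup all_algebra.
From mathcomp Require Import zify ring.

(** Extending a permutation s on the right by the value t creates an increasing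
    subsequence of length k exactly when s has one of length k - 1 with all its
    values below t, and dually for decreasing ones.  Letting t run through all
    values, the condition on the right extensions becomes: some value a is an
    upper bound of an increasing subsequence I of length k - 1 and a lower
    bound of a decreasing subsequence D of length l - 1.  Likewise, on the left,
    some value c bounds from above a decreasing subsequence D' of length l - 1
    and from below an increasing subsequence I' of length k - 1
    ([bicrucialP]).

    The thresholds can be chosen different ([dec_or_inc_apart]).  If c < a then
    D and D' are disjoint, and I meets each of them at most once, so the length
    of s is at least (k - 1) + 2 (l - 1) - 2 = k + 2 l - 5 ([dec_apart_size]).
    If a < c the roles of increasing and decreasing are exchanged; this is the
    first case for the complement of s, and the bound is 2 k + l - 5.  As
    l <= k, the least length is k + 2 l - 5, and the second case can reach it
    only if k = l, where complementation exchanges the two cases.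

    Put q = l - 1 and b = k - 3, so that the least length is 2 q + b.  In the
    case c < a at this length, equality in the count forces the q lowest values
    to appear in decreasing order, the b middle ones in increasing order and
    the q highest ones in decreasing order ([dec_apart_structure]).  Such an s
    is a shuffle of three words, hence is encoded by a word of up, flat and
    down steps (for low, middle and high values).  Avoidance of a decreasing
    subsequence of length l says precisely that this word is a lattice path
    which never goes below height 0 and has no flat step at height 0
    ([good_of_avoid], [good_avoid_dec]); conversely all these paths give
    bicrucial permutations ([good_bicrucial]).

    It remains to count the paths with q up, q down and b flat steps.  The
    paths from an arbitrary height satisfy a three-term recurrence, which is
    solved by the closed form [path_formula] ([num_paths_closed]).  For k = l
    the count doubles, because no such s has its complement of the same kind:
    its q >= 2 highest values would appear in both orders
    ([path_perms_complement]). *)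

Set Implicit Arguments.
Unset Strict Implicit.
Unset Printing Implicit Defensive.

(** * Monotone subsequences as sets of positions *)

(** The boolean d is the direction, true for increasing, so that statements
    and proofs that hold for both directions are written once. *)
Definition mono n (d : bool) (s : 'S_n) (A : {set 'I_n}) : Prop :=
  forall i j, i \in A -> j \in A -> i < j -> (s i < s j) = d.

Definition has_mono n (d : bool) (m : nat) (s : 'S_n) : Prop :=
  exists2 A : {set 'I_n}, #|A| = m & mono d s A.

Lemma perm_ltnC n (s : 'S_n) (i j : 'I_n) : i < j -> (s j < s i) = ~~ (s i < s j).
Proof.
move=> ij; rewrite -leqNgt [RHS]leq_eqVlt; case: eqP => // /val_inj /perm_inj e.
by rewrite e ltnn in ij.
Qed.

Lemma contains_incP n m (s : 'S_n) : reflect (has_mono true m s) (contains_inc m s).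
Proof.
apply: (iffP existsP) => [[A /andP[/eqP cA /forall_inP H]]|[A cA H]].
  exists A => // i j iA jA ij; move/forall_inP: (H i iA) => /(_ j jA).
  by rewrite ij /= => ->.
exists A; rewrite cA eqxx /=; apply/forall_inP => i iA; apply/forall_inP => j jA.
by apply/implyP => ij; rewrite H.
Qed.

Lemma contains_decP n m (s : 'S_n) : reflect (has_mono false m s) (contains_dec m s).
Proof.
apply: (iffP existsP) => [[A /andP[/eqP cA /forall_inP H]]|[A cA H]].
  exists A => // i j iA jA ij; move/forall_inP: (H i iA) => /(_ j jA).
  by rewrite ij /= perm_ltnC // => /negbTE.
exists A; rewrite cA eqxx /=; apply/forall_inP => i iA; apply/forall_inP => j jA.
by apply/implyP => ij; rewrite perm_ltnC // H.
Qed.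

Lemma mono_sub n d (s : 'S_n) (A B : {set 'I_n}) :
  A \subset B -> mono d s B -> mono d s A.
Proof. by move=> /subsetP AB H i j /AB iB /AB jB; apply: H. Qed.

Lemma has_mono_geq n d m (s : 'S_n) (A : {set 'I_n}) :
  mono d s A -> m <= #|A| -> has_mono d m s.
Proof.
move=> mA; rewrite cardE => mc.
exists [set x in take m (enum A)].
  rewrite cardsE; have/card_uniqP -> := take_uniq m (enum_uniq A).
  by rewrite size_takel.
apply: mono_sub mA; apply/subsetP => x; rewrite inE => /mem_take.
by rewrite mem_enum.
Qed.

Lemma mono_meet n (s : 'S_n) (A B : {set 'I_n}) :
  mono true s A -> mono false s B -> #|A :&: B| <= 1.
Proof.
move=> mA mB; rewrite leqNgt; apply/negP => /card_gt1P [x [y []]].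
rewrite !inE => /andP[xA xB] /andP[yA yB].
wlog xy : x y xA xB yA yB / x < y => [H nxy|_].
  case: (ltngtP x y) => [xy|yx|/val_inj e]; last by rewrite e eqxx in nxy.
    exact: (H x y).
  by apply: (H y x) => //; rewrite eq_sym.
by have := mA _ _ xA yA xy; rewrite mB.
Qed.

Lemma card_values n (s : 'S_n) (P : pred nat) :
  #|[set i : 'I_n | P (s i)]| = count P (iota 0 n).
Proof.
rewrite -(card_imset _ (@perm_inj _ s)) -sum1_count.
rewrite -[in RHS](subn0 n) -/(index_iota 0 n) big_mkord sum1dep_card.
apply: eq_card => v; rewrite !inE; apply/imsetP/idP => [[i]|Pv].
  by rewrite inE => ? ->.
by exists ((s^-1)%g v); rewrite ?inE permKV.
Qed.

Lemma card_value_range n (s : 'S_n) lo hi : lo <= hi <= n ->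
  #|[set i : 'I_n | lo <= s i < hi]| = hi - lo.
Proof.
case/andP=> lh hn; rewrite (card_values s (fun v => lo <= v < hi)) -size_filter.
have -> : n = lo + ((hi - lo) + (n - hi)) by lia.
rewrite !iotaD !filter_cat !size_cat !size_filter !add0n subnKC //.
have /eq_in_count -> : {in iota 0 lo, (fun v => lo <= v < hi) =1 pred0}.
  by move=> v; rewrite mem_iota /=; lia.
have /eq_in_count -> : {in iota lo (hi - lo), (fun v => lo <= v < hi) =1 predT}.
  by move=> v; rewrite mem_iota /=; lia.
have /eq_in_count -> : {in iota hi (n - hi), (fun v => lo <= v < hi) =1 pred0}.
  by move=> v; rewrite mem_iota /=; lia.
by rewrite !count_pred0 count_predT size_iota; lia.
Qed.

(** * Extensions and thresholds *)

Lemma lift_ltn n (h : 'I_n.+1) (i j : 'I_n) : (lift h i < lift h j) = (i < j).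
Proof. by rewrite /= !ltnNge leq_bump2. Qed.

Lemma lift_ltn_self n (h : 'I_n.+1) (i : 'I_n) : (lift h i < h) = (i < h).
Proof. by rewrite /= /bump; lia. Qed.

Lemma self_ltn_lift n (h : 'I_n.+1) (i : 'I_n) : (h < lift h i) = (h <= i).
Proof. by rewrite /= /bump; lia. Qed.

(** The set A of positions stays monotone when the value t is inserted at
    position p. *)
Definition fits n (d : bool) (p t : nat) (s : 'S_n) (A : {set 'I_n}) : Prop :=
  forall x, x \in A -> ((s x < t) == d) = (x < p).

(** As s has no monotone subsequence of length m + 1, one that appears after
    the insertion must use the inserted entry, and the rest of it is monotone
    in s.  Taking p extremal gives both the left and the right extensions. *)
Lemma has_mono_lift n d m (s : 'S_n) (p t : 'I_n.+1) :
  ~ has_mono d m.+1 s ->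
  has_mono d m.+1 (lift_perm p t s) <->
  exists A : {set 'I_n}, [/\ #|A| = m, mono d s A & fits d p t s A].
Proof.
move=> ns; split=> [[B cB mB]|[A [cA mA fA]]].
  pose A := lift p @^-1: B.
  have mA : mono d s A.
    move=> i j; rewrite !inE => iB jB ij.
    by have := mB _ _ iB jB; rewrite !lift_perm_lift !lift_ltn; apply.
  have eB : B :\ p = lift p @: A.
    apply/setP => x; rewrite !inE; case: (unliftP p x) => [y ->|->].
      by rewrite eq_sym neq_lift /= mem_imset ?inE //; apply: lift_inj.
    rewrite eqxx; apply/esym/imsetP => -[y _ e].
    by have := neq_lift p y; rewrite -e eqxx.
  have cA : #|A| = #|B :\ p| by rewrite eB card_imset //; apply: lift_inj.
  have pB : p \in B.
    apply/negPn/negP => npB; apply: ns; exists A => //; rewrite cA.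
    by have := cardsD1 p B; rewrite (negPf npB) cB add0n => <-.
  exists A; split=> //; first by move: (cardsD1 p B); rewrite pB cB cA => -[].
  move=> x; rewrite inE => xB.
  case: (ltnP x p) => px.
    have := mB _ _ xB pB; rewrite lift_ltn_self px => /(_ isT).
    by rewrite lift_perm_lift lift_perm_id lift_ltn_self => ->; rewrite eqxx.
  have := mB _ _ pB xB; rewrite self_ltn_lift px => /(_ isT).
  rewrite lift_perm_lift lift_perm_id self_ltn_lift => <-.
  by rewrite [t <= _]leqNgt; case: (_ < _).
exists (p |: lift p @: A).
  rewrite cardsU1 card_imset ?cA; last exact: lift_inj.
  suff -> : p \notin [set lift p x | x in A] by [].
  by apply/imsetP => -[y _ e]; have := neq_lift p y; rewrite -e eqxx.
move=> i j; rewrite !inE => /predU1P[->|/imsetP[x xA ->]] /predU1P[->|/imsetP[y yA ->]].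
- by rewrite ltnn.
- rewrite self_ltn_lift lift_perm_lift lift_perm_id self_ltn_lift => py.
  by have := fA _ yA; rewrite [y < p]ltnNge py [t <= s y]leqNgt /=;
    case: (s y < t); case: (d).
- rewrite lift_ltn_self lift_perm_lift lift_perm_id lift_ltn_self => py.
  by have := fA _ xA; rewrite py => /eqP.
- by rewrite !lift_perm_lift !lift_ltn; apply: mA.
Qed.

Definition separated n (s : 'S_n) (a : nat) (X Y : {set 'I_n}) : Prop :=
  (forall x, x \in X -> s x <= a) /\ (forall y, y \in Y -> a <= s y).

(** As members of F and G are nonempty, t = 0 can be served only by G and t = n
    only by F.  So there is a t that G serves while F serves t + 1, and this t
    separates the two witnesses. *)
Lemma thresholdP n (s : 'S_n) (F G : {set 'I_n} -> Prop) :
  (forall X, F X -> X != set0) -> (forall Y, G Y -> Y != set0) ->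
  (forall t : 'I_n.+1, (exists2 X, F X & forall x, x \in X -> s x < t) \/
                (exists2 Y, G Y & forall y, y \in Y -> t <= s y)) <->
  exists a X Y, [/\ F X, G Y & separated s a X Y].
Proof.
move=> F0 G0; split=> [H|[a [X [Y [FX GY [Xa aY]]]]] t]; last first.
  case: (leqP t a) => ta; [right; exists Y|left; exists X] => // z zX.
    exact: leq_trans ta (aY _ zX).
  exact: leq_ltn_trans (Xa _ zX) ta.
suff /(_ n (leqnn n)) : forall t, t <= n ->
    (exists a X Y, [/\ F X, G Y & separated s a X Y]) \/
    exists2 Y, G Y & forall y, y \in Y -> t <= s y.
  case=> // -[Y GY nY]; have /set0Pn [y /nY] := G0 _ GY.
  by rewrite leqNgt ltn_ord.
elim=> [_|t IH tn].
  case: (H ord0) => [[X FX X0]|[Y GY _]]; last by right; exists Y.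
  by have /set0Pn [x /X0] := F0 _ FX.
case: (IH (ltnW tn)) => [|[Y GY tY]]; first by left.
case: (H (@Ordinal n.+1 t.+1 tn)) => [[X FX Xt]|]; last by right.
by left; exists t, X, Y; split=> //; split.
Qed.

(** right_pair and left_pair are the conditions that the right, respectively
    left, extensions by all values impose on a permutation that avoids both
    patterns; k and l here are one less than the lengths of the patterns. *)
Definition right_pair n k l (s : 'S_n) (a : nat) : Prop :=
  exists X Y : {set 'I_n},
    [/\ #|X| = k /\ mono true s X, #|Y| = l /\ mono false s Y & separated s a X Y].

Definition left_pair n k l (s : 'S_n) (c : nat) : Prop :=
  exists Y X : {set 'I_n},
    [/\ #|Y| = l /\ mono false s Y, #|X| = k /\ mono true s X & separated s c Y X].

Lemma right_threshold n k l (s : 'S_n) : 0 < k -> 0 < l ->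
  ~~ contains_inc k.+1 s -> ~~ contains_dec l.+1 s ->
  [forall t : 'I_n.+1, contains_inc k.+1 (ext_right t s)
                           || contains_dec l.+1 (ext_right t s)] <->
  exists a, right_pair k l s a.
Proof.
move=> k0 l0 /contains_incP ni /contains_decP nd; rewrite /right_pair.
rewrite -(@thresholdP n s (fun X => #|X| = k /\ mono true s X)
                   (fun X => #|X| = l /\ mono false s X)); first last.
- by move=> X [cX _]; rewrite -card_gt0 cX.
- by move=> X [cX _]; rewrite -card_gt0 cX.
split=> [/forallP H t|H].
  case/orP: (H t) => [/contains_incP|/contains_decP] /has_mono_lift;
    case=> // X [cX mX fX]; [left|right]; exists X => // x /fX;
    rewrite [x < _]ltn_ord.
    by move/eqP.
  by rewrite ltnNge; case: (_ <= _).
apply/forallP => t; case: (H t) => [[X [cX mX] fX]|[X [cX mX] fX]].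
  apply/orP; left; apply/contains_incP/has_mono_lift => //; exists X; split=> // x xX.
  by rewrite fX // [RHS]ltn_ord.
apply/orP; right; apply/contains_decP/has_mono_lift => //; exists X; split=> // x xX.
by rewrite ltnNge fX // [RHS]ltn_ord.
Qed.

Lemma left_threshold n k l (s : 'S_n) : 0 < k -> 0 < l ->
  ~~ contains_inc k.+1 s -> ~~ contains_dec l.+1 s ->
  [forall t : 'I_n.+1, contains_inc k.+1 (ext_left t s)
                           || contains_dec l.+1 (ext_left t s)] <->
  exists a, left_pair k l s a.
Proof.
move=> k0 l0 /contains_incP ni /contains_decP nd; rewrite /left_pair.
rewrite -(@thresholdP n s (fun X => #|X| = l /\ mono false s X)
                   (fun X => #|X| = k /\ mono true s X)); first last.
- by move=> X [cX _]; rewrite -card_gt0 cX.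
- by move=> X [cX _]; rewrite -card_gt0 cX.
split=> [/forallP H t|H].
  case/orP: (H t) => [/contains_incP|/contains_decP] /has_mono_lift;
    case=> // X [cX mX fX]; [right|left]; exists X => // x /fX.
    by rewrite ltn0 [t <= _]leqNgt; case: (_ < _).
  by rewrite ltn0; case: (_ < _).
apply/forallP => t; case: (H t) => [[X [cX mX] fX]|[X [cX mX] fX]].
  apply/orP; right; apply/contains_decP/has_mono_lift => //; exists X; split=> // x xX.
  by rewrite fX // ltn0.
apply/orP; left; apply/contains_incP/has_mono_lift => //; exists X; split=> // x xX.
by rewrite ltnNge fX.
Qed.

Lemma bicrucialP n k l (s : 'S_n) : 0 < k -> 0 < l ->
  bicrucial k.+1 l.+1 s <->
  [/\ ~ has_mono true k.+1 s, ~ has_mono false l.+1 s,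
      exists a, right_pair k l s a & exists c, left_pair k l s c].
Proof.
move=> k0 l0; split.
  case/and5P=> n0 ni nd /(right_threshold k0 l0 ni nd) R /(left_threshold k0 l0 ni nd) L.
  by split=> //; [move/contains_incP: ni | move/contains_decP: nd].
case=> /(introN (contains_incP _ _)) ni /(introN (contains_decP _ _)) nd R L.
apply/and5P; split=> //.
- by case: R => a [X [_ [[cX _] _ _]]]; have := max_card X; rewrite cX card_ord; lia.
- exact/(right_threshold k0 l0 ni nd).
- exact/(left_threshold k0 l0 ni nd).
Qed.

(** * The two kinds of bicrucial permutations *)

(** With c < a the two decreasing subsequences are disjoint, one lying above
    the other; with a < c the two increasing ones are. *)
Definition dec_apart n k l (s : 'S_n) : Prop :=
  exists a c, [/\ right_pair k l s a, left_pair k l s c & c < a].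

Definition inc_apart n k l (s : 'S_n) : Prop :=
  exists a c, [/\ right_pair k l s a, left_pair k l s c & a < c].

Lemma mono_glue n (s : 'S_n) x (X Z : {set 'I_n}) :
  mono true s X -> mono true s Z -> x \in X -> x \in Z ->
  (forall y, y \in X -> s y <= s x) -> (forall y, y \in Z -> s x <= s y) ->
  mono true s (X :|: Z).
Proof.
move=> mX mZ xX xZ Xx xZ'.
have Xl y : y \in X -> y <= x.
  move=> yX; rewrite leqNgt; apply/negP => xy.
  by have := mX _ _ xX yX xy; rewrite ltnNge Xx.
have Zl y : y \in Z -> x <= y.
  move=> yZ; rewrite leqNgt; apply/negP => xy.
  by have := mZ _ _ yZ xZ xy; rewrite ltnNge xZ'.
move=> i j /setUP[iX|iZ] /setUP[jX|jZ] ij; [exact: mX| | |exact: mZ].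
  rewrite ltn_neqAle (leq_trans (Xx _ iX) (xZ' _ jZ)) andbT.
  by apply/eqP => /val_inj/perm_inj e; rewrite e ltnn in ij.
by have := Xl _ jX; have := Zl _ iZ; lia.
Qed.

(** If a = c, only the entry x of value a can lie in subsequences on both
    sides of the threshold.  If x is missing from one of the four, the
    threshold of that one can be moved by one, away from the other; if x is in
    all four, the two increasing ones join at x into one that is too long. *)
Lemma dec_or_inc_apart n k l (s : 'S_n) : 1 < k -> 0 < l -> ~ has_mono true k.+1 s ->
  (exists a, right_pair k l s a) -> (exists c, left_pair k l s c) ->
  dec_apart k l s \/ inc_apart k l s.
Proof.
move=> k1 l0 ni [a [X [Y [[cX mX] [cY mY] [Xa aY]]]]].
case=> [c [Y' [X' [[cY' mY'] [cX' mX'] [Yc cX'']]]]].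
case: (ltngtP a c) => ac.
- by right; exists a, c; split=> //; [exists X, Y | exists Y', X'].
- by left; exists a, c; split=> //; [exists X, Y | exists Y', X'].
subst c.
have /card_gt0P [y yY] : 0 < #|Y| by rewrite cY.
have an : a < n by apply: leq_ltn_trans (aY _ yY) (ltn_ord _).
pose x := (s^-1)%g (Ordinal an).
have sx : s x = a :> nat by rewrite permKV.
have ne z (Z : {set 'I_n}) : x \notin Z -> z \in Z -> s z != a :> nat.
  move=> xZ zZ; apply: contraNneq xZ; rewrite -sx => /val_inj/perm_inj e.
  by rewrite -e.
case: (boolP (x \in Y)) => xY; last first.
  left; exists a.+1, a; split=> //; last by exists Y', X'.
  exists X, Y; split=> //; split=> z zZ; first exact/leqW/Xa.
  by rewrite ltn_neqAle eq_sym (ne _ _ xY) ?aY.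
case: (boolP (x \in Y')) => xY'; last first.
  have a0 : 0 < a.
    have /card_gt0P [z zY] : 0 < #|Y'| by rewrite cY'.
    by have := Yc _ zY; have := ne _ _ xY' zY; lia.
  left; exists a, a.-1; split; [by exists X, Y | exists Y', X'| by rewrite prednK].
  split=> //; split=> z zZ.
    by have := Yc _ zZ; have := ne _ _ xY' zZ; lia.
  exact/(leq_trans (leq_pred _))/cX''.
case: (boolP (x \in X)) => xX; last first.
  have a0 : 0 < a.
    have /card_gt0P [z zY] : 0 < #|X| by rewrite cX; apply: ltnW.
    by have := Xa _ zY; have := ne _ _ xX zY; lia.
  right; exists a.-1, a; split; [exists X, Y | by exists Y', X'| by rewrite prednK].
  split=> //; split=> z zZ.
    by have := Xa _ zZ; have := ne _ _ xX zZ; lia.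
  exact/(leq_trans (leq_pred _))/aY.
case: (boolP (x \in X')) => xX'; last first.
  right; exists a, a.+1; split=> //; first by exists X, Y.
  exists Y', X'; split=> //; split=> z zZ; first exact/leqW/Yc.
  by rewrite ltn_neqAle eq_sym (ne _ _ xX') ?cX''.
case: ni; apply: (@has_mono_geq _ _ _ _ (X :|: X')).
  by apply: (mono_glue mX mX' xX xX') => z zZ; rewrite sx ?Xa ?cX''.
suff : X :&: X' \subset [set x].
  by move/subset_leq_card; rewrite cards1; have := cardsUI X X'; lia.
apply/subsetP => z /setIP[/Xa za /cX'' az]; rewrite inE; apply/eqP/(@perm_inj _ s)/val_inj.
by apply/eqP; rewrite /= sx eqn_leq za az.
Qed.

(** * Complementation *)

Definition complement n (s : 'S_n) : 'S_n := (s * perm (@rev_ord_inj n))%g.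

Lemma complementE n (s : 'S_n) i : complement s i = n - (s i).+1 :> nat.
Proof. by rewrite permM permE. Qed.

Lemma complementK n : involutive (@complement n).
Proof.
move=> s; apply/permP => i; apply/val_inj; rewrite /= !complementE.
by have := ltn_ord (s i); lia.
Qed.

Lemma mono_complement n d (s : 'S_n) A : mono d (complement s) A <-> mono (~~ d) s A.
Proof.
have E (i j : 'I_n) : i < j -> (complement s i < complement s j) = ~~ (s i < s j).
  move=> ij; rewrite -perm_ltnC // !complementE.
  by have := ltn_ord (s i); have := ltn_ord (s j); lia.
split=> H i j iA jA ij; have := H _ _ iA jA ij; rewrite E //.
  by move=> <-; rewrite negbK.
by move=> ->; rewrite negbK.
Qed.

Lemma separated_complement n (s : 'S_n) a X Y : a < n ->
  separated s a X Y -> separated (complement s) (n - a.+1) Y X.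
Proof.
move=> an [Xa aY]; split=> z zZ; rewrite complementE; have := ltn_ord (s z).
  by have := aY _ zZ; lia.
by have := Xa _ zZ; lia.
Qed.

Lemma has_mono_complement n d m (s : 'S_n) :
  has_mono d m (complement s) <-> has_mono (~~ d) m s.
Proof.
by split=> -[A cA mA]; exists A => //; apply/mono_complement; rewrite ?negbK.
Qed.

Lemma right_pair_complement n k l (s : 'S_n) a : 0 < l ->
  right_pair k l s a -> a < n /\ right_pair l k (complement s) (n - a.+1).
Proof.
move=> l0 [X [Y [[cX mX] [cY mY] S]]].
have an : a < n.
  have /card_gt0P [y yY] : 0 < #|Y| by rewrite cY.
  exact: leq_ltn_trans (S.2 _ yY) (ltn_ord _).
split=> //; exists Y, X; split; [| |exact: separated_complement];
  by split=> //; apply/mono_complement.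
Qed.

Lemma left_pair_complement n k l (s : 'S_n) a : 0 < k ->
  left_pair k l s a -> a < n /\ left_pair l k (complement s) (n - a.+1).
Proof.
move=> l0 [X [Y [[cX mX] [cY mY] S]]].
have an : a < n.
  have /card_gt0P [y yY] : 0 < #|Y| by rewrite cY.
  exact: leq_ltn_trans (S.2 _ yY) (ltn_ord _).
split=> //; exists Y, X; split; [| |exact: separated_complement];
  by split=> //; apply/mono_complement.
Qed.

Lemma inc_apart_complement n k l (s : 'S_n) : 0 < k -> 0 < l ->
  inc_apart k l s -> dec_apart l k (complement s).
Proof.
move=> k0 l0 [a [c [R L ac]]].
have [an R'] := right_pair_complement l0 R; have [cn L'] := left_pair_complement k0 L.
by exists (n - a.+1), (n - c.+1); split=> //; lia.
Qed.

Lemma bicrucial_complement n k l (s : 'S_n) : 0 < k -> 0 < l ->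
  bicrucial k.+1 l.+1 (complement s) = bicrucial l.+1 k.+1 s.
Proof.
suff H k' l' (t : 'S_n) : 0 < k' -> 0 < l' -> bicrucial l'.+1 k'.+1 t ->
      bicrucial k'.+1 l'.+1 (complement t).
  move=> k0 l0; apply/idP/idP => [|]; last exact: H.
  by move/H; rewrite complementK; apply.
move=> k0 l0 /(bicrucialP _ l0 k0) [ni nd [a R] [c L]]; apply/bicrucialP => //; split.
- by move/has_mono_complement.
- by move/has_mono_complement.
- by have [_ R'] := right_pair_complement k0 R; exists (n - a.+1).
- by have [_ L'] := left_pair_complement l0 L; exists (n - c.+1).
Qed.

(** * The least length and the shape of the extremal permutations *)

(** The two decreasing sets are disjoint, and each meets the increasing set of
    right_pair at most once. *)
Lemma dec_apart_size n k l (s : 'S_n) : dec_apart k l s -> k + l.*2 <= n.+2.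
Proof.
case=> a [c [[X [Y [[cX mX] [cY mY] [Xa aY]]]] L ca]].
case: L => [Y' [X' [[cY' mY'] [cX' mX'] [Yc cX'']]]].
have := mono_meet mX mY; have := mono_meet mX mY'.
have dY : Y :&: Y' = set0.
  apply/setP => z; rewrite !inE; apply/negP => /andP[/aY za /Yc az].
  by have := leq_trans za az; lia.
have := cardsUI Y Y'; rewrite dY cards0.
have := cardsUI X (Y :|: Y'); rewrite setIUr.
have := cardsUI (X :&: Y) (X :&: Y').
have := max_card (X :|: (Y :|: Y')); rewrite card_ord; lia.
Qed.

(** At the least length every inequality in the proof of [dec_apart_size] is an
    equality, for X and for X' alike.  So each of X and X' covers, with Y and
    Y', all positions and meets Y and Y'.  The values of X are at most a and
    those of Y at least a, so Y is the set of all entries with value at least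
    a; dually for Y', and everything between is in X. *)
Lemma dec_apart_structure n q b (s : 'S_n) : n = q.*2 + b -> dec_apart b.+2 q s ->
  [/\ mono false s [set i | s i < q], mono true s [set i | q <= s i < q + b]
    & mono false s [set i | q + b <= s i]].
Proof.
move=> en.
case=> a [c [[X [Y [[cX mX] [cY mY] [Xa aY]]]] L ca]].
case: L => [Y' [X' [[cY' mY'] [cX' mX'] [Yc cX'']]]].
have dY : Y :&: Y' = set0.
  apply/setP => z; rewrite !inE; apply/negP => /andP[/aY za /Yc az].
  by have := leq_trans za az; lia.
have full (Z : {set 'I_n}) : #|Z| = b.+2 -> mono true s Z ->
    [/\ forall z, [|| z \in Z, z \in Y | z \in Y'],
     exists2 z, z \in Z & z \in Y & exists2 z, z \in Z & z \in Y'].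
  move=> cZ mZ.
  have := mono_meet mZ mY; have := mono_meet mZ mY'.
  have := cardsUI Y Y'; rewrite dY cards0.
  have := cardsUI Z (Y :|: Y'); rewrite setIUr.
  have := cardsUI (Z :&: Y) (Z :&: Y').
  have := max_card (Z :|: (Y :|: Y')); rewrite card_ord => h1 h2 h3 h4 h5 h6.
  have /card_gt0P [y /setIP [yZ yY]] : 0 < #|Z :&: Y| by lia.
  have /card_gt0P [y' /setIP [yZ' yY']] : 0 < #|Z :&: Y'| by lia.
  have h7 : n <= #|Z :|: (Y :|: Y')| by lia.
  split; [|by exists y|by exists y'] => z.
  have /eqP/setP/(_ z) : Z :|: (Y :|: Y') == setT.
    by rewrite eqEcard subsetT cardsT card_ord.
  by rewrite !inE.
have [cov [x xX xY] _] := full X cX mX.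
have [cov' _ [y yX yY]] := full X' cX' mX'.
have sx : s x = a :> nat by apply/eqP; rewrite eqn_leq Xa // aY.
have sy : s y = c :> nat by apply/eqP; rewrite eqn_leq cX'' // Yc.
have EY : Y = [set i | a <= s i].
  apply/setP => z; rewrite inE; apply/idP/idP => [/aY //|az].
  case/or3P: (cov z) => [/Xa za||/Yc zc] //; last by lia.
  suff -> : z = x by [].
  by apply: (@perm_inj _ s); apply/val_inj; rewrite /= sx; lia.
have EY' : Y' = [set i | s i <= c].
  apply/setP => z; rewrite inE; apply/idP/idP => [/Yc //|az].
  case/or3P: (cov' z) => [/cX'' za|/aY zc|] //; last by lia.
  suff -> : z = y by [].
  by apply: (@perm_inj _ s); apply/val_inj; rewrite /= sy; lia.
have cq : c.+1 = q.
  have cn : c < n by rewrite -sy.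
  rewrite -cY' EY' -[LHS]subn0 -(card_value_range s) ?cn //.
have aq : a = q + b.
  have an : a <= n by rewrite -sx ltnW.
  suff : #|Y| = n - a by rewrite cY; lia.
  rewrite EY -(card_value_range s) ?an //=.
  by apply: eq_card => i; rewrite !inE ltn_ord andbT.
rewrite -aq -EY -[X in mono false s X]/[set i | s i < q].
have -> : [set i | s i < q] = Y' by rewrite EY'; apply/setP => i; rewrite !inE -cq ltnS.
split=> //; apply: mono_sub mX; apply/subsetP => i; rewrite inE -cq => /andP[ci ia].
have := cov i; rewrite EY EY' !inE; case: (i \in X) => //=; lia.
Qed.

Lemma mono_ltE n d (s : 'S_n) (A : {set 'I_n}) i j : mono d s A ->
  i \in A -> j \in A -> (s i < s j) = if d then i < j else j < i.
Proof.
move=> mA iA jA; case: (ltngtP i j) => [ij|ji|/val_inj ->]; last by rewrite !ltnn; case: d mA.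
  by rewrite (mA i j) //; case: d {mA}.
by rewrite (perm_ltnC s ji) (mA j i) //; case: d {mA}.
Qed.

(** * Words of steps *)

Definition step := option bool.
Local Notation up := (Some true : step).
Local Notation flat := (None : step).
Local Notation down := (Some false : step).

(** The lattice paths from height h to height 0 that stay nonnegative and have
    no flat step at height 0. *)
Fixpoint good (h : nat) (w : seq step) : bool :=
  if w is x :: w' then
    match x with
    | Some true => good h.+1 w'
    | Some false => (0 < h) && good h.-1 w'
    | None => (0 < h) && good h w'
    end
  else h == 0.

Definition cnt (x : step) (w : seq step) : nat := count (fun y => y == x) w.

Arguments cnt : simpl never.

Lemma cnt_cons x y w : cnt x (y :: w) = (y == x) + cnt x w.
Proof. by []. Qed.

Lemma cnt_nil x : cnt x [::] = 0.
Proof. by []. Qed.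

Lemma cnt_cat x w w' : cnt x (w ++ w') = cnt x w + cnt x w'.
Proof. exact: count_cat. Qed.


(** The height after i steps is h plus the ups minus the downs among them; the
    next lemmas restate [good] by these heights, which is how permutations
    produce and use it. *)
Lemma good_below h w i : good h w -> cnt down (take i w) <= h + cnt up (take i w).
Proof.
elim: w h i => [|x w IH] h [|i] //=.
case: x => [[]|] /=; rewrite !cnt_cons /=; first by move/(IH _ i); lia.
  by case/andP=> h0 /(IH _ i); lia.
by case/andP=> h0 /(IH _ i); lia.
Qed.

Lemma good_flat h w i : good h w -> i < size w -> nth flat w i = flat ->
  cnt down (take i w) < h + cnt up (take i w).
Proof.
elim: w h i => [|x w IH] h [|i] //=; case: x => [[]|] //=; rewrite ?cnt_cons ?cnt_nil /=.
- by case/andP=> h0; lia.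
- by move=> g si /(IH _ _ g si); lia.
- by case/andP=> h0 g si /(IH _ _ g si); lia.
- by case/andP=> h0 g si /(IH _ _ g si); lia.
Qed.

Lemma good_end h w : good h w -> cnt down w = h + cnt up w.
Proof.
elim: w h => [|x w IH] h /=; first by move/eqP->.
case: x => [[]|] /=; rewrite !cnt_cons /=; first by move/IH; lia.
  by case/andP=> h0 /IH; lia.
by case/andP=> h0 /IH; lia.
Qed.

Lemma good_intro h w :
  (forall i, i <= size w -> cnt down (take i w) <= h + cnt up (take i w)) ->
  (forall i, i < size w -> nth flat w i = flat ->
     cnt down (take i w) < h + cnt up (take i w)) ->
  cnt down w = h + cnt up w -> good h w.
Proof.
elim: w h => [|x w IH] h /=; first by move=> _ _; rewrite !cnt_nil; lia.
move=> below fl e.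
have b1 := below 1 isT; have f1 := fl 0 isT.
have below' i := below i.+1; have fl' i := fl i.+1.
case: x below' fl' e b1 f1 {below fl} => [[]|] /= below fl;
  rewrite take0 !cnt_cons !cnt_nil /= => e b1 f1.
- by apply: IH => [i /below|i si /(fl i si)|]; rewrite ?cnt_cons /=; lia.
- have h0 : 0 < h by lia.
  by rewrite h0 /=; apply: IH => [i /below|i si /(fl i si)|]; rewrite ?cnt_cons /=; lia.
- have h0 : 0 < h by have := f1 erefl; lia.
  by rewrite h0 /=; apply: IH => [i /below|i si /(fl i si)|]; rewrite ?cnt_cons /=; lia.
Qed.

Lemma cnt_take_mono x w i j : i <= j -> cnt x (take i w) <= cnt x (take j w).
Proof.
by move=> ij; rewrite -(take_takel _ ij) -[X in _ <= cnt x X](cat_take_drop i) cnt_cat leq_addr.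
Qed.

Lemma cnt_take_lt x w i j : i < j -> i < size w -> nth flat w i = x ->
  cnt x (take i w) < cnt x (take j w).
Proof.
move=> ij iw ex; apply: leq_trans (cnt_take_mono x w ij).
by rewrite (take_nth flat iw) -cats1 cnt_cat cnt_cons ex eqxx; lia.
Qed.

Lemma cnt_take_le x w i : cnt x (take i w) <= cnt x w.
Proof. by rewrite -[X in _ <= cnt x X](cat_take_drop i) cnt_cat leq_addr. Qed.

Lemma cnt_take_card n x w i : size w = n -> i <= n ->
  cnt x (take i w) = #|[set j : 'I_n | (j < i) && (nth flat w j == x)]|.
Proof.
move=> sw le_in; rewrite /cnt -(map_nth_iota0 flat) ?sw // count_map -sum1_count.
rewrite -sum1dep_card -{1}(subn0 i) -/(index_iota 0 i) big_mkord.
rewrite (big_ord_widen_cond _ (fun j => nth flat w j == x) (fun=> 1) le_in).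
by apply: eq_bigl => j; rewrite andbC.
Qed.

Lemma size_cnt w : size w = cnt up w + cnt flat w + cnt down w.
Proof. by elim: w => [|[[]|] w /= ->] //; rewrite !cnt_cons /=; lia. Qed.

(** * Permutations encoded by words *)

(** The ups of w receive the values q - 1, ..., 0 from left to right, the flats
    q, ..., q + b - 1, and the downs 2 q + b - 1, ..., q + b. *)
Definition shuffle_value q b (w : seq step) i :=
  match nth flat w i with
  | Some true => q.-1 - cnt up (take i w)
  | None => q + cnt flat (take i w)
  | Some false => (q.*2 + b).-1 - cnt down (take i w)
  end.

Definition balanced q b w := [&& cnt up w == q, cnt flat w == b & cnt down w == q].

(** The kind of step at the positions that hold the value v. *)
Definition step_of q b v : step :=
  if v < q then up else if v < q + b then flat else down.

Definition word_of q b n (s : 'S_n) : seq step := [seq step_of q b (s i) | i <- enum 'I_n].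

Lemma step_of_up q b v : (step_of q b v == up) = (v < q).
Proof. by rewrite /step_of; case: ltnP => // _; case: ltnP. Qed.

Lemma step_of_flat q b v : (step_of q b v == flat) = (q <= v < q + b).
Proof. by rewrite /step_of; case: ltnP => // _; case: ltnP. Qed.

Lemma step_of_down q b v : (step_of q b v == down) = (q + b <= v).
Proof.
rewrite /step_of; case: ltnP => [vq|_]; last by case: ltnP.
by apply/esym/negbTE; rewrite -ltnNge ltn_addr.
Qed.

Lemma balanced_size q b w : balanced q b w -> size w = q.*2 + b.
Proof. by case/and3P=> /eqP cu /eqP cf /eqP cd; rewrite size_cnt; lia. Qed.

Section Balanced.
Variables (q b : nat) (w : seq step).
Hypothesis bw : balanced q b w.
Let n := q.*2 + b.

Let cu : cnt up w = q. Proof. by case/and3P: bw => /eqP. Qed.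
Let cf : cnt flat w = b. Proof. by case/and3P: bw => _ /eqP. Qed.
Let cd : cnt down w = q. Proof. by case/and3P: bw => _ _ /eqP. Qed.

Lemma cnt_take_lt_total x i : i < n -> nth flat w i = x ->
  cnt x (take i w) < cnt x w.
Proof.
move=> ii ex; rewrite -[X in _ < cnt x X]take_size (balanced_size bw) -/n.
by apply: cnt_take_lt => //; rewrite (balanced_size bw).
Qed.

Lemma step_of_shuffle i : i < n -> step_of q b (shuffle_value q b w i) = nth flat w i.
Proof.
move=> ii; rewrite /shuffle_value /step_of.
case e: (nth flat w i) => [[]|]; have := cnt_take_lt_total ii e; rewrite ?cu ?cf ?cd => h.
- by rewrite ifT //; lia.
- by rewrite ifF ?ifF //; lia.
- by rewrite ifF ?ifT //; lia.
Qed.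

Lemma shuffle_value_lt i : i < n -> shuffle_value q b w i < n.
Proof.
move=> ii; rewrite /shuffle_value; have n0 : 0 < n by lia.
case e: (nth flat w i) => [[]|]; have := cnt_take_lt_total ii e;
  rewrite ?cu ?cf ?cd /n in n0 *; lia.
Qed.

Lemma shuffle_value_mono i j : i < j < n -> nth flat w i = nth flat w j ->
  (shuffle_value q b w i < shuffle_value q b w j) = (nth flat w i == flat) /\
  (shuffle_value q b w i != shuffle_value q b w j).
Proof.
case/andP=> ij jn e; have ii : i < n by lia.
have iw : i < size w by rewrite (balanced_size bw).
rewrite /shuffle_value -e.
case ei: (nth flat w i) => [[]|]; have := cnt_take_lt ij iw ei;
  have := cnt_take_lt_total jn (etrans (esym e) ei); 
  rewrite ?cu ?cf ?cd ?eqxx -?[Some _ == None]/false => h1 h2; split; lia.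
Qed.

Lemma shuffle_value_inj i j : i < n -> j < n ->
  shuffle_value q b w i = shuffle_value q b w j -> i = j.
Proof.
move=> ii jj; wlog ij : i j ii jj / i < j => [H|].
  by case: (ltngtP i j) => // [/H|/H h /esym /h]; [apply|move=> ->].
move=> e; have := step_of_shuffle ii; rewrite e step_of_shuffle // => /esym el.
by have [_] := shuffle_value_mono (introT andP (conj ij jj)) el; rewrite e eqxx.
Qed.

Lemma ex_shuffle : exists s : 'S_n, forall i : 'I_n, s i = shuffle_value q b w i :> nat.
Proof.
pose f (i : 'I_n) := Ordinal (shuffle_value_lt (ltn_ord i)).
have fi : injective f.
  move=> i j /(congr1 val) /= e; apply: val_inj; exact: shuffle_value_inj e.
by exists (perm fi) => i; rewrite permE.
Qed.

End Balanced.

Definition encodes q b n w (s : 'S_n) : Prop :=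
  forall i : 'I_n, s i = shuffle_value q b w i :> nat.

(** The value of an entry within its class is determined by the number of
    entries of the class to the left of it: as the class is monotone, those are
    the entries of the class with larger (or smaller) values. *)
Lemma structured_encodes n q b (s : 'S_n) w : n = q.*2 + b ->
  mono false s [set i | s i < q] -> mono true s [set i | q <= s i < q + b] ->
  mono false s [set i | q + b <= s i] ->
  w = word_of q b s ->
  balanced q b w /\ encodes q b w s.
Proof.
move=> en mU mF mD ew.
have sw : size w = n by rewrite ew size_map size_enum_ord.
have nw (i : 'I_n) : nth flat w i = step_of q b (s i).
  by rewrite ew /word_of (nth_map i) ?size_enum_ord // nth_ord_enum.
have cw i x : i <= n ->
    cnt x (take i w) = #|[set j : 'I_n | (j < i) && (step_of q b (s j) == x)]|.
  by move=> ii; rewrite (cnt_take_card _ sw ii); apply: eq_card => j; rewrite !inE nw.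
have cW lo hi x : lo <= hi <= n ->
    (forall v, v < n -> (step_of q b v == x) = (lo <= v < hi)) ->
    cnt x w = hi - lo.
  move=> lh E; rewrite -(card_value_range s lh) -[w in LHS]take_size sw cw //.
  by apply: eq_card => j; rewrite !inE ltn_ord /= E.
split.
  apply/and3P; split; apply/eqP.
  - by rewrite (cW 0 q) ?subn0 ?en => [||v _]; rewrite ?step_of_up //; lia.
  - by rewrite (cW q (q + b)) ?addKn ?en => [||v _]; rewrite ?step_of_flat //; lia.
  - by rewrite (cW (q + b) n) ?en => [||v vn]; rewrite ?step_of_down; lia.
move=> i; rewrite /shuffle_value nw.
have li := ltn_ord i; have ls := ltn_ord (s i).
rewrite /step_of; case: ltnP => hq; last case: ltnP => hqb.
- rewrite cw 1?ltnW // (@eq_card _ _ [set j | (s i).+1 <= s j < q]).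
    by rewrite card_value_range; lia.
  move=> j; rewrite !inE step_of_up; case: (ltnP (s j) q) => jq; last by rewrite !andbF.
  by rewrite !andbT (mono_ltE mU) ?inE.
- rewrite cw 1?ltnW // (@eq_card _ _ [set j | q <= s j < s i]).
    by rewrite card_value_range; lia.
  move=> j; rewrite !inE step_of_flat.
  case jq: (q <= s j) => /=; last by rewrite andbF.
  case: (ltnP (s j) (q + b)) => jqb; last by rewrite andbF; lia.
  by rewrite andbT (mono_ltE mF) ?inE ?jq ?hq.
- rewrite cw 1?ltnW // (@eq_card _ _ [set j | (s i).+1 <= s j < n]).
    by rewrite card_value_range; lia.
  move=> j; rewrite !inE step_of_down ltn_ord andbT.
  case: (leqP (q + b) (s j)) => jqb; last by rewrite andbF; lia.
  by rewrite andbT (mono_ltE mD) ?inE.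
Qed.

(** * Good words and bicrucial permutations *)

Definition ascent (x y : step) : bool :=
  match x, y with
  | Some true, Some true => false
  | Some true, _ => true
  | None, Some true => false
  | None, _ => true
  | Some false, _ => false
  end.

Section Encoded.
Variables (q b n : nat) (w : seq step) (s : 'S_n).
Hypotheses (en : n = q.*2 + b) (bw : balanced q b w) (es : encodes q b w s).

Let ln (i : 'I_n) : i < q.*2 + b. Proof. by rewrite -en. Qed.
Let sw : size w = n. Proof. by rewrite (balanced_size bw). Qed.
Let cu : cnt up w = q. Proof. by case/and3P: bw => /eqP. Qed.
Let cf : cnt flat w = b. Proof. by case/and3P: bw => _ /eqP. Qed.
Let cd : cnt down w = q. Proof. by case/and3P: bw => _ _ /eqP. Qed.

Lemma nth_encodes (i : 'I_n) : nth flat w i = step_of q b (s i).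
Proof. by rewrite es (step_of_shuffle bw) ?ln. Qed.

Lemma encodes_ltn (i j : 'I_n) : i < j ->
  (s i < s j) = ascent (nth flat w i) (nth flat w j).
Proof.
move=> ij; case: (eqVneq (nth flat w i) (nth flat w j)) => [e|].
  have [] := shuffle_value_mono bw (introT andP (conj ij (ln j))) e.
  by rewrite -!es -e => -> _; case: (nth flat w i) => [[]|].
rewrite !nth_encodes /step_of.
by case: (ltnP (s i) q) => ?; [|case: (ltnP (s i) (q + b)) => ?];
  (case: (ltnP (s j) q) => ?; [|case: (ltnP (s j) (q + b)) => ?]) => //= _; lia.
Qed.

(** The downs before position i and the ups from i on.  They form a decreasing
    subsequence, of size q minus the height of the path at i, and every
    decreasing set is contained in one of them but for one flat at most. *)
Definition cut (i : nat) : {set 'I_n} :=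
  [set j : 'I_n | nth flat w j == if j < i then down else up].

Lemma card_class x : #|[set j : 'I_n | nth flat w j == x]| = cnt x w.
Proof.
rewrite -[w in RHS]take_size sw (cnt_take_card x sw (leqnn n)).
by apply: eq_card => j; rewrite !inE ltn_ord.
Qed.

Lemma card_cut i : i <= n -> #|cut i| + cnt up (take i w) = cnt down (take i w) + q.
Proof.
move=> le_in; rewrite !(cnt_take_card _ sw le_in) -cu -card_class.
rewrite -(cardsID [set j : 'I_n | j < i] (cut i)).
rewrite -(cardsID [set j : 'I_n | j < i] [set j : 'I_n | _ == up]).
have -> : cut i :&: [set j : 'I_n | j < i] =
    [set j : 'I_n | (j < i) && (nth flat w j == down)].
  by apply/setP => j; rewrite !inE; case: ifP; rewrite ?andbT ?andbF.
have -> : cut i :\: [set j : 'I_n | j < i] =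
    [set j : 'I_n | nth flat w j == up] :\: [set j : 'I_n | j < i].
  by apply/setP => j; rewrite !inE; case: ifP.
rewrite -addnA; congr addn; rewrite addnC; congr addn.
by apply: eq_card => j; rewrite !inE andbC.
Qed.

Lemma mono_cut i : mono false s (cut i).
Proof.
move=> x y; rewrite !inE => /eqP hx /eqP hy xy; rewrite encodes_ltn // hx hy.
by case: (ltnP x i) => // ix; rewrite ltnNge (leq_trans ix (ltnW xy)).
Qed.

(** Where the path has negative height the cut is too long.  A flat entry at i
    is above the later ups and below the earlier downs, so it can be added to
    the cut at i, which is then too long at height 0. *)
Lemma good_of_avoid : ~ has_mono false q.+1 s -> good 0 w.
Proof.
move=> nd; apply: good_intro => [i|i|]; rewrite ?add0n ?cu //; rewrite sw.
  move=> le_in; rewrite leqNgt; apply/negP => lt_ud; apply: nd.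
  by apply: (has_mono_geq (@mono_cut i)); have := card_cut le_in; lia.
move=> lt_in fi; rewrite ltnNge; apply/negP => le_ud; apply: nd.
have ni : Ordinal lt_in \notin cut i by rewrite inE ltnn /= fi.
apply: (@has_mono_geq _ _ _ _ (Ordinal lt_in |: cut i)); last first.
  by rewrite cardsU1 ni; have := card_cut (ltnW lt_in); lia.
move=> x y; rewrite !inE => /predU1P[->|hx] /predU1P[->|hy] xy; rewrite ?ltnn // ?encodes_ltn //=.
- by move: hy; rewrite fi ltnNge (ltnW xy) /= => /eqP ->.
- by move: hx; rewrite xy => /eqP ->.
- by rewrite -encodes_ltn //; apply: (mono_cut (i := i)); rewrite ?inE.
Qed.

Hypothesis gw : good 0 w.

(** In a decreasing set all downs come before all ups, and at most one flat
    lies between them.  So, apart from that flat, the set is contained in a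
    cut, made at the flat if there is one, and good words bound the cut. *)
Lemma good_avoid_dec : ~ has_mono false q.+1 s.
Proof.
case=> A cA mA.
have nasc x y : x \in A -> y \in A -> ascent (nth flat w x) (nth flat w y) -> y <= x.
  move=> xA yA; rewrite leqNgt => a; apply/negP => xy.
  by have := mA _ _ xA yA xy; rewrite encodes_ltn ?a.
case: (boolP [exists x in A, nth flat w x == flat]) => [/exists_inP [x xA /eqP fx]|].
  have sub : A :\ x \subset cut x.
    apply/subsetP => y; rewrite !inE => /andP[yx yA].
    have := nasc _ _ xA yA; have := nasc _ _ yA xA; rewrite fx.
    have {yx} : y != x :> nat by [].
    by case: (nth flat w y) => [[]|] /= yx h1 h2; case: ltnP => ?; rewrite ?eqxx //; lia.
  have := subset_leq_card sub; have := cardsD1 x A; rewrite xA.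
  have := good_flat gw; rewrite sw => /(_ _ (ltn_ord x) fx).
  have := card_cut (ltnW (ltn_ord x)); lia.
move=> /exists_inPn nf.
(* just after the last down of A, or 0 if A has no down *)
pose i := \max_(y in A | nth flat w y == down) y.+1.
have ile : i <= n by apply/bigmax_leqP => y _; apply: ltn_ord.
have sub : A \subset cut i.
  apply/subsetP => x xA; rewrite inE; have := nf x xA.
  case ex: (nth flat w x) => [[]|] // _.
    rewrite ltnNge; suff -> : i <= x by [].
    apply/bigmax_leqP => y /andP[yA /eqP ey].
    have := nasc _ _ xA yA; rewrite ex ey => /(_ isT).
    rewrite leq_eqVlt => /predU1P[/val_inj e|//].
    by rewrite e ex in ey.
  suff -> : x < i by [].
  by apply: (@leq_bigmax_cond _ _ (fun y : 'I_n => y.+1)); rewrite xA ex.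
have := subset_leq_card sub; have := card_cut ile; have := good_below i gw; lia.
Qed.

(** An increasing set has at most one up, at most one down, and b flats. *)
Lemma good_avoid_inc : ~ has_mono true b.+3 s.
Proof.
case=> A cA mA.
have mc x : x != flat -> mono false s [set j : 'I_n | nth flat w j == x].
  move=> xf i j; rewrite !inE => /eqP ei /eqP ej ij; rewrite encodes_ltn // ei ej.
  by case: x xf {ei ej} => [[]|].
have hU := mono_meet mA (mc up isT); have hD := mono_meet mA (mc down isT).
have hF := card_class flat; rewrite cf in hF.
set U := [set j | _] in hU; set D := [set j | _] in hD; set F := [set j | _] in hF.
have sub : A \subset F :|: (A :&: U :|: A :&: D).
  by apply/subsetP => x; rewrite !inE => ->; case: (nth flat w x) => [[]|].
suff : #|A| <= b + (1 + 1) by lia.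
apply: leq_trans (subset_leq_card sub) _; rewrite -hF.
apply: leq_trans (leq_card_setU _ _) _; rewrite leq_add2l.
exact: leq_trans (leq_card_setU _ _) (leq_add hU hD).
Qed.

(** The entries with values from q - 1 to q + b are the first up, all flats and
    the last down.  No flat precedes the first up, where the height is 0, or
    follows the last down. *)
Lemma spine_mono : 0 < q -> mono true s [set j : 'I_n | q.-1 <= s j < (q + b).+1].
Proof.
move=> q0 i j; rewrite !inE => /andP[_ hi] /andP[hj _] ij; rewrite encodes_ltn //.
have lti := cnt_take_lt_total bw (ln i) erefl; have ltj := cnt_take_lt_total bw (ln j) erefl.
have iw : i < size w by rewrite sw.
have jw : j < size w by rewrite sw.
have lt_ij := cnt_take_lt ij iw erefl.
have gi := good_below i gw; have gj := good_below j gw.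
have fi := good_flat gw iw; have fj := good_flat gw jw.
have := cnt_take_le up w j; have := cnt_take_mono up w (ltnW ij); rewrite cu.
move: hi hj; rewrite !es /shuffle_value.
case ei: (nth flat w i) lti lt_ij fi => [[]|] lti lt_ij fi;
  case ej: (nth flat w j) ltj fj => [[]|] ltj fj //=; rewrite ?cu ?cd in lti ltj;
  try (have := fi erefl); try (have := fj erefl); lia.
Qed.

(** The entries of [spine_mono] serve as the increasing subsequence on both
    sides, with all downs as the decreasing one on the right and all ups on
    the left. *)
Lemma good_bicrucial : 0 < q -> bicrucial b.+3 q.+1 s.
Proof.
move=> q0; apply/bicrucialP => //.
have cX : #|[set j : 'I_n | q.-1 <= s j < (q + b).+1]| = b.+2.
  by rewrite card_value_range; lia.
have cY : #|cut n| = q.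
  have := card_cut (leqnn n); rewrite take_oversize ?sw // cu cd; lia.
have cY' : #|cut 0| = q.
  have := card_cut (leq0n n); rewrite take0 !cnt_nil; lia.
split; [exact: good_avoid_inc|exact: good_avoid_dec| |].
  exists (q + b), [set j : 'I_n | q.-1 <= s j < (q + b).+1], (cut n).
  split; [by split=> //; apply: spine_mono|by split=> //; apply: mono_cut|].
  split=> x; rewrite inE; first by case/andP.
  by rewrite ltn_ord nth_encodes step_of_down.
exists q.-1, (cut 0), [set j : 'I_n | q.-1 <= s j < (q + b).+1].
split; [by split=> //; apply: mono_cut|by split=> //; apply: spine_mono|].
split=> x; rewrite inE; last by case/andP.
by rewrite ltn0 nth_encodes step_of_up; lia.
Qed.

End Encoded.

Lemma dec_apart_encodes n q b (s : 'S_n) w : n = q.*2 + b ->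
  w = word_of q b s ->
  dec_apart b.+2 q s -> ~ has_mono false q.+1 s ->
  [/\ balanced q b w, encodes q b w s & good 0 w].
Proof.
move=> en ew ap nd; have [mU mF mD] := dec_apart_structure en ap.
have [bw es] := structured_encodes en mU mF mD ew.
by split=> //; apply: good_of_avoid en bw es nd.
Qed.

(** * Counting paths *)

Fixpoint words (n : nat) : seq (seq step) :=
  if n is n'.+1 then [seq x :: w | x <- [:: up; flat; down], w <- words n'] else [:: [::]].

Lemma mem_words n w : (w \in words n) = (size w == n).
Proof.
elim: n w => [|n IH] w; first by case: w.
apply/allpairsP/eqP => [[[x v] /= [_ + ->]]|]; first by rewrite IH => /eqP <-.
case: w => // x w [sw]; exists (x, w); split=> //=; first by case: x => [[]|].
by rewrite IH sw.
Qed.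

Lemma words_uniq n : uniq (words n).
Proof.
elim: n => [//|n IH]; apply: allpairs_uniq => //.
by move=> [x v] [y v'] _ _ [-> ->].
Qed.

Definition num_paths (n h b : nat) : nat :=
  count (fun w => good h w && (cnt flat w == b)) (words n).

Lemma num_paths0 h b : num_paths 0 h b = (h == 0) && (b == 0).
Proof. by rewrite /num_paths /= addn0 cnt_nil [0 == b]eq_sym. Qed.

Lemma count0 T (a : pred T) s : a =1 pred0 -> count a s = 0.
Proof. by move/eq_count->; rewrite count_pred0. Qed.

(** The recurrence on the first step: at height 0 it must be an up, and at
    positive height it can be an up, a down, or a flat if flats are left. *)
Lemma num_pathsS0 n b : num_paths n.+1 0 b = num_paths n 1 b.
Proof.
rewrite /num_paths /= !count_cat !count_map /=.
by rewrite (@count0 _ (preim (cons flat) _)) // !addn0.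
Qed.

Lemma num_pathsSS0 n h : num_paths n.+1 h.+1 0 = num_paths n h.+2 0 + num_paths n h 0.
Proof.
rewrite /num_paths /= !count_cat !count_map /= !addn0 (@count0 _ (preim (cons flat) _)) //.
by move=> w /=; rewrite andbF.
Qed.

Lemma num_pathsSSS n h b : num_paths n.+1 h.+1 b.+1 =
  num_paths n h.+2 b.+1 + num_paths n h b.+1 + num_paths n h.+1 b.
Proof.
rewrite /num_paths /= !count_cat !count_map /= !addn0 -addnA; congr addn.
by rewrite addnC.
Qed.

Lemma num_paths_short n h b : n < h + b -> num_paths n h b = 0.
Proof.
move=> lt; apply/eqP; rewrite eqn0Ngt -has_count; apply/hasPn => w.
rewrite mem_words => /eqP sw.
apply/negP => /andP[/good_end e /eqP f]; move: sw; rewrite size_cnt e f; lia.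
Qed.

(** * The minimal bicrucial permutations *)

Definition path_perms q b n : {set 'S_n} :=
  [set s : 'S_n | [&& good 0 (word_of q b s), balanced q b (word_of q b s)
    & [forall i, s i == shuffle_value q b (word_of q b s) i :> nat]]].

Lemma path_permsP q b n (s : 'S_n) :
  reflect [/\ good 0 (word_of q b s), balanced q b (word_of q b s)
            & encodes q b (word_of q b s) s] (s \in path_perms q b n).
Proof.
rewrite inE; apply: (iffP and3P) => [[g bw /forallP e]|[g bw e]]; split=> //.
  by move=> i; apply/eqP.
by apply/forallP => i; apply/eqP/e.
Qed.

Lemma good_balanced q b w : size w = q.*2 + b -> good 0 w -> cnt flat w = b ->
  balanced q b w.
Proof.
move=> sw /good_end e f; move: sw; rewrite size_cnt e f => sw.
by apply/and3P; split; apply/eqP; lia.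
Qed.

(** Reading off the word is a bijection to the good words: it is injective
    since the word determines the values, and surjective by [ex_shuffle]. *)
Lemma card_path_perms q b n : n = q.*2 + b -> #|path_perms q b n| = num_paths n 0 b.
Proof.
move=> en; rewrite /num_paths -size_filter cardE -(size_map (@word_of q b n)).
apply/perm_size/uniq_perm.
- rewrite map_inj_in_uniq ?enum_uniq // => s s'; rewrite !mem_enum.
  move=> /path_permsP [_ _ e] /path_permsP [_ _ e'] ew; apply/permP => i.
  by apply: val_inj; rewrite /= e e' ew.
- exact/filter_uniq/words_uniq.
move=> w; rewrite mem_filter mem_words; apply/mapP/andP => [[s]|[/andP[g /eqP f] /eqP sw]].
  rewrite mem_enum => /path_permsP [g bw _] ->; split; last by rewrite (balanced_size bw) en.
  by rewrite g; case/and3P: bw.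
have bw : balanced q b w by apply: good_balanced; rewrite // -en.
have [s es] : exists s : 'S_n, encodes q b w s by subst n; apply: ex_shuffle.
have ew : w = word_of q b s.
  apply: (@eq_from_nth _ flat); first by rewrite sw size_map size_enum_ord.
  rewrite sw => i lt_in; rewrite (nth_encodes en bw es (Ordinal lt_in)).
  by rewrite (nth_map (Ordinal lt_in)) ?size_enum_ord // (nth_ord_enum _ (Ordinal lt_in)).
by exists s => //; rewrite mem_enum; apply/path_permsP; rewrite -ew.
Qed.

Lemma mem_tagged n0 (A : {set 'S_n0}) (P : forall n, 'S_n -> bool) :
  (forall n (s : 'S_n), P n s -> n = n0) -> (forall s, (s \in A) = P n0 s) ->
  forall n (s : 'S_n),
  (existT (fun n => 'S_n) n s \in [seq existT (fun n => 'S_n) n0 s | s in A]) = P n s.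
Proof.
move=> Pn AP n s; apply/mapP/idP => [[s' + e]|Ps].
  have en : n = n0 := congr1 (@projT1 _ _) e.
  subst n; move/eqP: e; rewrite eq_Tagged /= => /eqP ->.
  by rewrite mem_enum AP.
have en := Pn _ _ Ps; subst n; by exists s; rewrite ?mem_enum ?AP.
Qed.

Section Minimal.
Variables q b : nat.
Hypotheses (q0 : 0 < q) (qb : q <= b.+2).
Let n0 := q.*2 + b.

Lemma bicrucial_size n (s : 'S_n) : bicrucial b.+3 q.+1 s -> n0 <= n.
Proof.
case/(bicrucialP _ (ltn0Sn _) q0) => ni _ R L; rewrite /n0.
have [/dec_apart_size|/(inc_apart_complement (ltn0Sn _) q0)/dec_apart_size] :=
  dec_or_inc_apart (isT : 1 < b.+2) q0 ni R L; lia.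
Qed.

Lemma path_perms_bicrucial (s : 'S_n0) : s \in path_perms q b n0 -> bicrucial b.+3 q.+1 s.
Proof. by case/path_permsP => g bw e; apply: good_bicrucial bw e g q0. Qed.

Lemma dec_apart_path_perms (s : 'S_n0) : ~ has_mono false q.+1 s -> dec_apart b.+2 q s ->
  s \in path_perms q b n0.
Proof.
move=> nd ap; have [bw e g] := dec_apart_encodes (erefl n0) erefl ap nd.
exact/path_permsP.
Qed.

(** If the increasing subsequences are apart, the complement of s has its
    decreasing ones apart, with k and l exchanged.  The size bound for it is
    2 k + l - 5 <= k + 2 l - 5, so k = l. *)
Lemma bicrucial_path_perms (s : 'S_n0) : bicrucial b.+3 q.+1 s =
  (s \in path_perms q b n0) || ((b.+2 == q) && (complement s \in path_perms q b n0)).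
Proof.
apply/idP/orP => [bs|[/path_perms_bicrucial //|/andP[/eqP e /path_perms_bicrucial]]]; last first.
  by rewrite e bicrucial_complement // -{2}e.
case/(bicrucialP _ (ltn0Sn _) q0): (bs) => ni nd R L.
case: (dec_or_inc_apart (isT : 1 < b.+2) q0 ni R L) => [/(dec_apart_path_perms nd)|]; first by left.
move/(inc_apart_complement (ltn0Sn _) q0) => ap; right.
have e : b.+2 = q by have := dec_apart_size ap; rewrite /n0; lia.
rewrite e eqxx; apply: dec_apart_path_perms; last by rewrite e in ap *.
by rewrite e in ni; move/has_mono_complement.
Qed.

(** The highest q values of s are in decreasing order.  If the complement were
    of the same kind, its lowest q values would be so too, which are at the same
    positions: then these would also be in increasing order in s. *)
Lemma path_perms_complement (s : 'S_n0) : 1 < q ->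
  s \in path_perms q b n0 -> complement s \notin path_perms q b n0.
Proof.
move=> q1 /path_permsP[_ bw e]; apply/negP => /path_permsP [_ bw' e'].
have m := mono_cut (erefl n0) bw e (i := n0).
have /mono_complement m' := mono_cut (erefl n0) bw' e' (i := 0).
have E : cut n0 (word_of q b (complement s)) 0 = cut n0 (word_of q b s) n0.
  apply/setP => j; rewrite !inE ltn0 ltn_ord.
  rewrite (nth_encodes (erefl n0) bw e) (nth_encodes (erefl n0) bw' e').
  rewrite step_of_up step_of_down complementE.
  by have := ltn_ord (s j); rewrite /n0; lia.
rewrite E in m'; have := mono_meet m' m; rewrite setIid.
have := card_cut (erefl n0) bw (leqnn n0).
have sw := balanced_size bw.
case/and3P: bw => /eqP cu _ /eqP cd.
by rewrite take_oversize ?sw // cu cd; lia.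
Qed.

Lemma card_bicrucial : #|[set s : 'S_n0 | bicrucial b.+3 q.+1 s]| =
  (b.+2 == q).+1 * num_paths n0 0 b.
Proof.
rewrite -(card_path_perms (erefl n0)).
case: (boolP (b.+2 == q)) => eq /=; last first.
  rewrite mul1n; apply: eq_card => s.
  by rewrite [LHS]inE bicrucial_path_perms (negPf eq) orbF.
have inj := can_inj (@complementK n0).
have -> : [set s : 'S_n0 | bicrucial b.+3 q.+1 s] =
    path_perms q b n0 :|: @complement n0 @^-1: path_perms q b n0.
  apply/setP => s; rewrite in_setU [LHS]inE bicrucial_path_perms eq.
  by congr orb; rewrite [RHS]inE.
rewrite cardsU (_ : _ :&: _ = set0) ?cards0 ?subn0.
  by rewrite card_preimset // mul2n addnn.
apply/setP => s; rewrite [RHS]inE; apply/negP => /setIP[sP]; rewrite inE.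
by apply/negP/path_perms_complement => //; rewrite -(eqP eq).
Qed.

Lemma minimal_bicrucialE n (s : 'S_n) : 0 < num_paths n0 0 b ->
  minimal_bicrucial b.+3 q.+1 s = (n == n0) && bicrucial b.+3 q.+1 s.
Proof.
move=> p0; rewrite andbC /minimal_bicrucial; case: (boolP (bicrucial _ _ s)) => //= bs.
have := bicrucial_size bs; rewrite leq_eqVlt => /predU1P[<-|lt]; last first.
  rewrite (gtn_eqF lt); apply/negP => /forallP/(_ (Ordinal lt))/forallP /= H.
  have /card_gt0P [u uP] : 0 < #|path_perms q b n0| by rewrite (card_path_perms (erefl n0)).
  by have := H u; rewrite path_perms_bicrucial.
rewrite eqxx; apply/forallP => m; apply/forallP => u; apply/negP => /bicrucial_size.
by rewrite leqNgt ltn_ord.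
Qed.

End Minimal.

(** * The closed form *)

Import GRing.Theory Num.Theory.
Local Open Scope ring_scope.

(** The number of good words from height m - d to 0 with m downs, d ups and b
    flats.  By Lagrange inversion of the generating function it is the sum over
    i <= d of (m - i) (m + b + i - 1)! / (m! b! i!), and two binomial sums
    give the form below, which for m = d is the number of standard Young
    tableaux of the hook-like shape (b + 2, 2, ..., 2) with m rows. *)
Definition path_formula (m d b : nat) : rat :=
  ((m + d + b)`!)%:R * (m%:R * (m%:R + b%:R + 1) - (m%:R + b%:R) * d%:R)
   / ((m`!)%:R * (d`!)%:R * (b`!)%:R * (m%:R + b%:R) * (m%:R + b%:R + 1)).

Ltac rat_nz := by rewrite ?(natr1, =^~ natrD) pnatr_eq0; lia.

Lemma natr_fact_neq0 n : (n`!)%:R != 0 :> rat.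
Proof. by rewrite pnatr_eq0 -lt0n fact_gt0. Qed.

(** The formula satisfies the recurrence of [num_paths], in the boundary cases
    too: where a number of steps vanishes, so does the corresponding term. *)
Lemma path_formula_diag m b : path_formula m.+1 m.+1 b = path_formula m.+1 m b.
Proof.
rewrite /path_formula (_ : m.+1 + m.+1 + b = (m.*2 + b).+2)%N; last by lia.
rewrite (_ : m.+1 + m + b = (m.*2 + b).+1)%N; last by lia.
rewrite !factS !natrM -!natr1 natrD -mul2n natrM.
have := natr_fact_neq0 m; have := natr_fact_neq0 b.
move: (_`!%:R) (m`!%:R) (b`!%:R) => N M B B0 M0.
by field; rewrite M0 B0 /=; apply/and3P; split; rat_nz.
Qed.

Lemma path_formula_rec m d b : path_formula m.+1 d.+1 b.+1 =
  path_formula m.+1 d b.+1 + path_formula m d.+1 b.+1 + path_formula m.+1 d.+1 b.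
Proof.
rewrite /path_formula (_ : m.+1 + d.+1 + b.+1 = (m + d + b).+3)%N; last by lia.
rewrite (_ : m.+1 + d + b.+1 = (m + d + b).+2)%N; last by lia.
rewrite (_ : m + d.+1 + b.+1 = (m + d + b).+2)%N; last by lia.
rewrite (_ : m.+1 + d.+1 + b = (m + d + b).+2)%N; last by lia.
rewrite !factS !natrM -!natr1 !natrD.
have := natr_fact_neq0 m; have := natr_fact_neq0 b; have := natr_fact_neq0 d.
move: (_`!%:R) (m`!%:R) (d`!%:R) (b`!%:R) => N M D B D0 B0 M0.
field; rewrite M0 D0 B0 /=; do ?[apply/andP; split]; rat_nz.
Qed.

Lemma path_formula_rec_d0 m b : path_formula m.+1 0 b.+1 =
  path_formula m 0 b.+1 + path_formula m.+1 0 b.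
Proof.
rewrite /path_formula !addn0 (_ : m.+1 + b.+1 = (m + b).+2)%N; last by lia.
rewrite (_ : m + b.+1 = (m + b).+1)%N; last by lia.
rewrite (_ : m.+1 + b = (m + b).+1)%N; last by lia.
rewrite !factS !natrM -!natr1 !natrD.
have := natr_fact_neq0 m; have := natr_fact_neq0 b.
move: (_`!%:R) (m`!%:R) (b`!%:R) => N M B B0 M0.
field; rewrite M0 B0 /=; do ?[apply/andP; split]; rat_nz.
Qed.

Lemma path_formula_rec_b0 m d : path_formula m.+2 d.+1 0 =
  path_formula m.+2 d 0 + path_formula m.+1 d.+1 0.
Proof.
rewrite /path_formula !addn0 (_ : m.+2 + d.+1 = (m + d).+3)%N; last by lia.
rewrite (_ : m.+2 + d = (m + d).+2)%N; last by lia.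
rewrite (_ : m.+1 + d.+1 = (m + d).+2)%N; last by lia.
rewrite !factS !natrM -!natr1 !natrD.
have := natr_fact_neq0 m; have := natr_fact_neq0 d.
move: (_`!%:R) (m`!%:R) (d`!%:R) => N M D D0 M0.
field; rewrite M0 D0 /=; do ?[apply/andP; split]; rat_nz.
Qed.

Lemma path_formula_rec_d0b0 m : path_formula m.+2 0 0 = path_formula m.+1 0 0.
Proof.
rewrite /path_formula !addn0 !factS !natrM -!natr1.
have := natr_fact_neq0 m; move: (m`!%:R) => M M0.
field; rewrite M0 /=; do ?[apply/andP; split]; rat_nz.
Qed.

(** A path of n steps from height h with b flats has u ups and u + h downs,
    where n = 2 u + h + b.  The case n = 0 is excluded since the formula is then
    0 / 0. *)
Lemma num_paths_closed n h u b : (n = u.*2 + h + b)%N -> (0 < n)%N ->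
  (num_paths n h b)%:R = path_formula (u + h) u b.
Proof.
elim: n h u b => [//|n IH] h u b en _; case: (posnP n) => [n0|n0].
  subst n; have -> : u = 0%N by lia.
  have [[-> ->]|[-> ->]] : (h = 1 /\ b = 0 \/ h = 0 /\ b = 1)%N by lia.
    by rewrite num_pathsSS0 !num_paths0 /path_formula; apply/eqP; vm_compute.
  by rewrite num_pathsS0 !num_paths0 /path_formula /=; field.
have short h' b' : (n < h' + b')%N -> (num_paths n h' b')%:R = 0 :> rat by move/num_paths_short->.
case: h u b en => [|h] [|u] b en.
- by rewrite num_pathsS0 short ?addn0; [rewrite /path_formula mulr0 mul0r subrr mulr0 mul0r|lia].
- rewrite num_pathsS0 (IH _ u) //; last by lia.
  by rewrite addn0 addn1 path_formula_diag.
- case: b en => [|b] en.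
    rewrite num_pathsSS0 natrD short; last by lia.
    rewrite (IH _ 0%N) //; last by lia.
    by case: h en => [|h] en; [lia|rewrite add0r !add0n path_formula_rec_d0b0].
  rewrite num_pathsSSS !natrD short; last by lia.
  by rewrite !(IH _ 0%N) //; try lia; rewrite add0r !add0n path_formula_rec_d0.
- case: b en => [|b] en.
    rewrite num_pathsSS0 !natrD (IH _ u) // 1?(IH _ u.+1) //; try lia.
    rewrite (_ : u.+1 + h.+1 = (u + h).+2)%N; last by lia.
    rewrite (_ : u + h.+2 = (u + h).+2)%N; last by lia.
    by rewrite addSn path_formula_rec_b0.
  rewrite num_pathsSSS !natrD (IH _ u) // ?(IH _ u.+1) //; try lia.
  rewrite (_ : u + h.+2 = (u.+1 + h).+1)%N; last by lia.
  by rewrite addnS path_formula_rec.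
Qed.

Theorem corollary21 (k l : nat) (hl : (2 <= l)%N) (hlk : (l <= k)%N)
    (hk : (3 <= k)%N) :
  exists ps : seq {n : nat & 'S_n},
    [/\ uniq ps,
        forall (n : nat) (s : 'S_n),
          (existT (fun n : nat => 'S_n) n s \in ps) = minimal_bicrucial k l s
      & (size ps)%:R =
          ((1 + (k == l)%:R) * ((k + 2 * l - 5)`!)%:R)
          / ((k + l - 3)%:R * (k + l - 4)%:R
             * ((l - 1)`!)%:R * ((l - 2)`!)%:R * ((k - 3)`!)%:R) :> rat].
Proof.
have [b ek] : exists b, k = b.+3 by exists (k - 3)%N; lia.
have [q el] : exists q, l = q.+2 by exists (l - 2)%N; lia.
subst k l; pose n0 := (q.+1.*2 + b)%N; have qb : (q.+1 <= b.+2)%N by [].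
have pE : (num_paths n0 0 b)%:R = path_formula q.+1 q.+1 b.
  by rewrite (@num_paths_closed _ 0 q.+1 b) ?addn0.
have fz := natr_fact_neq0.
have p0 : (0 < num_paths n0 0 b)%N.
  rewrite lt0n -(pnatr_eq0 rat) pE /path_formula.
  rewrite !mulf_neq0 ?invr_neq0 ?mulf_neq0 ?fz //; try rat_nz.
  rewrite [_ - _](_ : _ = q.+1%:R); [rat_nz|ring].
pose bic := [set s : 'S_n0 | bicrucial b.+3 q.+2 s].
exists [seq existT (fun n => 'S_n) n0 s | s in bic]; split.
- by rewrite map_inj_uniq ?enum_uniq // => s s' /eqP; rewrite eq_Tagged => /eqP.
- apply: mem_tagged => [n s|s]; rewrite minimal_bicrucialE //; first by case/andP => /eqP.
  by rewrite inE eqxx.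
rewrite size_map -cardE card_bicrucial // natrM pE /path_formula eqSS.
rewrite (_ : q.+1 + q.+1 + b = b.+3 + 2 * q.+2 - 5)%N; last by lia.
rewrite (_ : b.+3 + q.+2 - 3 = (b + q).+2)%N; last by lia.
rewrite (_ : b.+3 + q.+2 - 4 = (b + q).+1)%N; last by lia.
rewrite (_ : q.+2 - 1 = q.+1)%N; last by lia.
rewrite (_ : q.+2 - 2 = q)%N; last by lia.
rewrite (_ : b.+3 - 3 = b)%N; last by lia.
rewrite factS !natrM -!natr1 !natrD.
move: (fz q) (fz b); move: (_`!%:R) (q`!%:R) (b`!%:R) => N Q B Q0 B0.
by field; rewrite Q0 B0 /=; do ?[apply/andP; split]; rat_nz.
Qed.
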